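(* For every real $\delta$ with $0\le\delta\le\frac12$, $$R(\delta)\le H\left(\frac12-\sqrt{\delta(1-\delta)}\right).$$
   Context: $A(n,d)$ denotes the maximal size of a subset of the Hamming cube $\{0,1\}^n$ in which the Hamming distance between any two distinct points is at least $d$. For $0\le\delta\le\frac12$, $$R(\delta)=\limsup_{n\to\infty}\frac1n\log_2 A(n,\lfloor\delta n\rfloor).$$ $H$ is the binary entropy function $H(x)=-x\log_2x-(1-x)\log_2(1-x)$ for $0<x<1$, with $H(0)=H(1)=0$. *)

(* Defs.v *)
From HB Require Import structures.
From mathcomp Require Import all_boot all_order all_algebra.
From mathcomp Require Import all_classical all_reals all_analysis.

Set Implicit Arguments.
Unset Strict Implicit.
Unset Printing Implicit Defensive.

Import Order.TTheory GRing.Theory Num.Theory.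
Import numFieldNormedType.Exports.

Local Open Scope ring_scope.

Definition cube (n : nat) := {ffun 'I_n -> bool}.

Definition hamming_dist (n : nat) (x y : cube n) : nat :=
  #|[pred i | x i != y i]|.

Definition has_min_dist (n d : nat) (C : {set cube n}) : bool :=
  [forall x in C, forall y in C, (x != y) ==> (d <= hamming_dist x y)%N].

Definition max_code_size (n d : nat) : nat :=
  (\max_(C : {set cube n} | has_min_dist d C) #|C|)%N.

Definition log2 {R : realType} (x : R) : R := ln x / ln 2.

(* [Num.truncn x] is the floor of [x], as a natural number, when [0 <= x].
   [limn_esup] is total, hence no boundedness side condition; its value lies in
   [\bar R]. The term of index 0 is 0, by [0^-1 = 0], and is irrelevant. *)
Definition asymptotic_rate {R : realType} (delta : R) : \bar R :=
  limn_esup (fun n : nat =>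
    (n%:R^-1 * log2 (max_code_size n (Num.truncn (delta * n%:R)))%:R)%:E).

(* Only used on [0, 1]; the second branch covers the endpoints. *)
Definition binary_entropy {R : realType} (x : R) : R :=
  if 0 < x < 1 then - x * log2 x - (1 - x) * log2 (1 - x) else 0.

(* Main.v *)
Require Import Defs.
From HB Require Import structures.
From mathcomp Require Import all_boot all_order all_algebra.
From mathcomp Require Import all_classical all_reals all_analysis.
From mathcomp Require Import zify ring lra.

(* Let chi_S be the characters of the cube and let f >= 0 be a function on the
   subsets S of {1..n}, supported in a family B, with A f >= lam f, where A is
   the adjacency operator of the cube on subsets. For a code C of minimal
   distance d put fhat x y := sum_S f S chi_S(x) chi_S(y). In
     Q := sum_(x, y in C) 2 (d - dist x y) (fhat x y)^2
   only the diagonal terms can be positive, so Q <= 2d |C| (sum f)^2. On the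
   other hand A acts on the Fourier side as multiplication by n - 2 dist x y,
   so Q = sum_(S, T) h S f T (sum_(x in C) chi_S(x) chi_T(x))^2, where
   h := A f - (n - 2d) f >= (lam - n + 2d) f; the terms S = T alone give
   Q >= (lam - n + 2d) |C|^2 sum f^2. By Cauchy-Schwarz,
   (lam - n + 2d) |C| <= 2d |B| (the argument of Navon and Samorodnitsky).

   For B the ball of radius r = floor(p n), a function f concentrated on the
   last m layers achieves lam = 2 (1 - 1/m) (n sqrt(p (1 - p)) - O(1)), while
   |B| <= 2^(n H(p)). Thus R(delta) <= H(p) as soon as
   2 sqrt(p (1 - p)) > 1 - 2 delta, that is p > 1/2 - sqrt(delta (1 - delta)),
   and one lets p decrease to that value. *)

Set Implicit Arguments.
Unset Strict Implicit.
Unset Printing Implicit Defensive.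

Import Order.TTheory GRing.Theory Num.Theory.
Import numFieldNormedType.Exports.

Local Open Scope ring_scope.

(** * Characters of the cube and the linear programming bound *)

Definition chi {R : realFieldType} n (S : {set 'I_n}) (x : cube n) : R :=
  \prod_(i in S) (-1) ^+ x i.

Definition flip n (i : 'I_n) (S : {set 'I_n}) : {set 'I_n} :=
  if i \in S then S :\ i else i |: S.

Lemma flipK n (i : 'I_n) : involutive (flip i).
Proof.
move=> S; rewrite /flip; case: (boolP (i \in S)) => iS.
  by rewrite finset.setD11 finset.setD1K.
by rewrite finset.setU11 finset.setU1K.
Qed.

Section Lp.
Variable R : realFieldType.

Lemma chi_sqr n S (x : cube n) : chi S x * chi S x = 1 :> R.
Proof.
by rewrite /chi -big_split /= big1 // => i _; rewrite -expr2 sqrr_sign.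
Qed.

Lemma chi_flip n i S (x : cube n) :
  chi (flip i S) x = (-1) ^+ x i * chi S x :> R.
Proof.
have chiU (T : {set _}) : i \notin T -> chi (i |: T) x = (-1) ^+ x i * chi T x :> R.
  by move=> iT; rewrite /chi big_setU1.
rewrite /flip; case: ifPn => iS; last exact: chiU.
rewrite -[in RHS](finset.setD1K iS) chiU ?finset.setD11 // mulrA -expr2 sqrr_sign mul1r //.
Qed.

Lemma sum_sign_mul n (x y : cube n) :
  \sum_i (-1) ^+ x i * (-1) ^+ y i = n%:R - 2 * (hamming_dist x y)%:R :> R.
Proof.
have -> : n%:R = \sum_(i < n) 1 :> R by rewrite sumr_const card_ord.
rewrite /hamming_dist -sum1_card natr_sum mulr_sumr.
rewrite [X in _ - X]big_mkcond -sumrB; apply: eq_bigr => i _.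
by rewrite inE; case: (x i) (y i) => -[]; rewrite ?mulr1n //=; lra.
Qed.

(** Summing [2 f i f j <= f i ^ 2 + f j ^ 2] over all pairs proves this case of Cauchy-Schwarz. *)
Lemma sum_sqr_le (I : finType) (B : {set I}) (f : I -> R) :
  (\sum_(i in B) f i) ^+ 2 <= #|B|%:R * \sum_(i in B) f i ^+ 2.
Proof.
have sum_sym : \sum_(i in B) \sum_(j in B) (f i ^+ 2 + f j ^+ 2) =
               2 * (#|B|%:R * \sum_(i in B) f i ^+ 2).
  under eq_bigr do rewrite big_split /= sumr_const.
  by rewrite big_split /= sumr_const sumrMnl -[X in X + _]mulr_natl -[X in _ + X]mulr_natl; ring.
rewrite -(@ler_pM2l _ 2) ?ltr0n // -sum_sym expr2 mulr_suml mulr_sumr.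
apply: ler_sum => i _; rewrite !mulr_sumr; apply: ler_sum => j _.
by have := sqr_ge0 (f i - f j); rewrite !expr2; lra.
Qed.

Section Bound.
Variables (n d : nat) (C : {set cube n}) (f : {set 'I_n} -> R) (lam : R).
Hypotheses (Cd : has_min_dist d C) (f0 : forall S, 0 <= f S).
Hypothesis flam : forall S, lam * f S <= \sum_i f (flip i S).
Hypothesis lamd : n%:R - 2 * d%:R <= lam.

Let fhat x y := \sum_S f S * (chi S x * chi S y).
Let h S := \sum_i f (flip i S) - (n%:R - 2 * d%:R) * f S.

(** Reindexing by the involution [flip i] moves it from [f] onto the two characters, where it yields
    the sign [(-1) ^+ x i * (-1) ^+ y i]; these signs add up to [n - 2 * hamming_dist x y]. *)
Lemma fourier_adjacency x y :
  (2 * d%:R - 2 * (hamming_dist x y)%:R) * fhat x y =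
  \sum_S h S * (chi S x * chi S y).
Proof.
have -> : 2 * d%:R - 2 * (hamming_dist x y)%:R =
   \sum_i (-1) ^+ x i * (-1) ^+ y i - (n%:R - 2 * d%:R) :> R.
  by rewrite sum_sign_mul; ring.
rewrite (eq_bigr (fun S => \sum_i f (flip i S) * (chi S x * chi S y) -
    (n%:R - 2 * d%:R) * (f S * (chi S x * chi S y)))); last first.
  by move=> S _; rewrite /h mulrBl mulr_suml -!mulrA.
rewrite sumrB -mulr_sumr mulrBl; congr (_ - _).
rewrite exchange_big mulr_suml; apply: eq_bigr => i _.
rewrite (reindex_inj (inv_inj (@flipK n i))) /= /fhat mulr_sumr.
by apply: eq_bigr => S _; rewrite flipK !chi_flip; ring.
Qed.

Lemma lp_bound :
  (lam - n%:R + 2 * d%:R) * #|C|%:R * \sum_S f S ^+ 2 <=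
  2 * d%:R * (\sum_S f S) ^+ 2.
Proof.
have [->|C0] := eqVneq C finset.set0.
  by rewrite cards0 mulr0 mul0r mulr_ge0 ?sqr_ge0 ?mulr_ge0 ?ler0n.
have Cgt0 : 0 < #|C|%:R :> R by rewrite ltr0n card_gt0.
rewrite -(ler_pM2l Cgt0).
pose Q := \sum_(x in C) \sum_(y in C)
  (2 * d%:R - 2 * (hamming_dist x y)%:R) * fhat x y ^+ 2.
have fhatxx x : fhat x x = \sum_S f S.
  by apply: eq_bigr => S _; rewrite chi_sqr mulr1.
have Qle : Q <= #|C|%:R * (2 * d%:R * (\sum_S f S) ^+ 2).
  rewrite mulr_natl -sumr_const; apply: ler_sum => x xC.
  rewrite (bigD1 x) //= fhatxx -[leRHS]addr0; apply: lerD.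
    by rewrite ler_wpM2r ?sqr_ge0 // gerBl mulr_ge0.
  apply: sumr_le0 => y /andP[yC yx]; rewrite mulr_le0_ge0 ?sqr_ge0 //.
  rewrite subr_le0 ler_pM2l ?ltr0n // ler_nat.
  move/forall_inP : Cd => /(_ x xC) /forall_inP /(_ y yC) /implyP; apply.
  by rewrite eq_sym.
apply: le_trans Qle.
have h0 S : (lam - n%:R + 2 * d%:R) * f S <= h S.
  by have := flam S; rewrite /h; lra.
have c0 : 0 <= lam - n%:R + 2 * d%:R by rewrite -addrA (addrC (- _)) -opprB subr_ge0.
have h_ge0 S : 0 <= h S by apply: le_trans (h0 S); rewrite mulr_ge0.
(* One factor [fhat] absorbs the distance and turns [f] into [h]; exchanging the sums then separates
   [x] from [y], which leaves a square. *)
have -> : Q = \sum_S \sum_T h S * f T * (\sum_(x in C) chi S x * chi T x) ^+ 2.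
  transitivity (\sum_(x in C) \sum_(y in C) \sum_S \sum_T
     h S * f T * ((chi S x * chi T x) * (chi S y * chi T y))).
    apply: eq_bigr => x _; apply: eq_bigr => y _.
    rewrite expr2 mulrA fourier_adjacency mulr_suml; apply: eq_bigr => S _.
    by rewrite mulr_sumr; apply: eq_bigr => T _; ring.
  under eq_bigr do rewrite exchange_big.
  rewrite exchange_big; apply: eq_bigr => S _.
  under eq_bigr do rewrite exchange_big.
  rewrite exchange_big; apply: eq_bigr => T _.
  rewrite expr2 mulr_suml mulr_sumr; apply: eq_bigr => x _.
  by rewrite !mulr_sumr.
rewrite mulr_sumr mulr_sumr; apply: ler_sum => S _.
rewrite (bigD1 S) //= -[leLHS]addr0; apply: lerD; last first.
  by apply: sumr_ge0 => T _; rewrite mulr_ge0 ?sqr_ge0 // mulr_ge0.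
under eq_bigr do rewrite chi_sqr.
rewrite sumr_const.
have -> : #|C|%:R * ((lam - n%:R + 2 * d%:R) * #|C|%:R * f S ^+ 2) =
  ((lam - n%:R + 2 * d%:R) * f S) * f S * #|C|%:R ^+ 2 by ring.
by rewrite ler_wpM2r ?sqr_ge0 // ler_wpM2r.
Qed.

Lemma code_size_le (B : {set {set 'I_n}}) :
  (forall S, S \notin B -> f S = 0) -> (exists S, f S != 0) ->
  (lam - n%:R + 2 * d%:R) * #|C|%:R <= 2 * d%:R * #|B|%:R.
Proof.
move=> fB [S0 fS0].
have fgt0 : 0 < \sum_S f S ^+ 2.
  rewrite (bigD1 S0) //= ltr_pwDl ?sumr_ge0 // => [|S _]; last exact: sqr_ge0.
  by rewrite exprn_gt0 // lt_def fS0 f0.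
rewrite -(ler_pM2r fgt0); apply: le_trans lp_bound _.
rewrite -[leRHS]mulrA ler_wpM2l ?mulr_ge0 ?ler0n //.
have sumB (g : {set 'I_n} -> R) : (forall S, S \notin B -> g S = 0) ->
    \sum_S g S = \sum_(S in B) g S.
  by move=> gB; rewrite [LHS](bigID (mem B)) /= [X in _ + X]big1 ?addr0.
rewrite !sumB //; first exact: sum_sqr_le.
by move=> S /fB ->; rewrite expr0n.
Qed.

End Bound.
End Lp.

(** * The test function on the last layers of a ball *)

Lemma sum_flip_card (R : realFieldType) n (S : {set 'I_n}) (a : nat -> R) :
  \sum_i a #|flip i S| =
  #|S|%:R * a #|S|.-1 + (n%:R - #|S|%:R) * a #|S|.+1.
Proof.
rewrite (bigID (mem S)) /=; congr (_ + _).
  rewrite mulr_natl -sumr_const; apply: eq_bigr => i iS.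
  by rewrite /flip iS (cardsD1 i S) iS.
have -> : n%:R - #|S|%:R = #|~: S|%:R :> R.
  by apply/eqP; rewrite subr_eq -natrD addnC cardsC card_ord.
rewrite mulr_natl -sumr_const; apply: eq_big => i; first by rewrite inE.
by move=> iS; rewrite /flip (negbTE iS) cardsU1 iS.
Qed.

(* With j = k + 1 - s this is the parabola j (m + 1 - j), which by truncated
   subtraction vanishes outside s <= k < s + m. *)
Definition bump_weight (s m k : nat) : nat := ((k.+1 - s) * (s + m - k))%N.

(** The second difference of the parabola is -2, also at both ends of the range, since the parabola
    itself vanishes where the truncation begins. [0 < s] makes [k.-1] a true predecessor. *)
Lemma bump_weight_concave s m k : (0 < s)%N -> (s <= k < s + m)%N ->
  (bump_weight s m k.-1 + bump_weight s m k.+1 + 2 = 2 * bump_weight s m k)%N.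
Proof.
case: k => [|k] s0 /andP[sk km]; first by move: sk; rewrite leqNgt s0.
rewrite /bump_weight [k.+1.-1]/=.
have [i ik] : exists i, k.+1 = (s + i)%N by exists (k.+1 - s)%N; lia.
have [l lm] : exists l, m = (i + l).+1 by exists (m - i.+1)%N; lia.
have -> : (k.+1 - s = i)%N by lia.
have -> : (k.+3 - s = i.+2)%N by lia.
have -> : (k.+2 - s = i.+1)%N by lia.
have -> : (s + m - k = l.+2)%N by lia.
have -> : (s + m - k.+2 = l)%N by lia.
have -> : (s + m - k.+1 = l.+1)%N by lia.
ring.
Qed.

Lemma bump_weight_ge s m k : (s <= k < s + m)%N -> (m <= bump_weight s m k)%N.
Proof.
move=> /andP[sk km]; rewrite /bump_weight.
have [i ki] : exists i, k = (s + i)%N by exists (k - s)%N; lia.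
have [l ml] : exists l, m = (i + l).+1 by exists (m - i.+1)%N; lia.
have -> : (k.+1 - s = i.+1)%N by lia.
have -> : (s + m - k = l.+1)%N by lia.
by rewrite ml mulSn mulnS; lia.
Qed.

Lemma bump_weight_eq0 s m k : ~~ (s <= k < s + m)%N -> bump_weight s m k = 0%N.
Proof. by rewrite /bump_weight => ?; apply/eqP; rewrite muln_eq0; lia. Qed.

(* The factor t ^+ k, with t close to sqrt (k / (n - k)), balances the weights
   k and n - k of the two neighbouring layers in sum_flip_card. *)
Definition bump {R : realFieldType} (t : R) (s m k : nat) : R :=
  t ^+ k * (bump_weight s m k)%:R.

(** On the layers [s <= k < s + m] the bounds on [q] make each neighbouring term at least
    [q * t ^+ k] times its weight. By concavity the two weights sum to [2 v - 2], where [v] is the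
    weight at [k], and this is at least [(2 - 2 / m) v] as [v >= m]. Off these layers the left side
    is zero. *)
Lemma bump_adjacency (R : realFieldType) (n s m : nat) (t q : R) (k : nat) :
  (0 < s)%N -> (0 < m)%N -> (k <= n)%N -> 0 < t -> 0 <= q -> q * t <= s%:R ->
  q <= (n%:R + 1 - (s + m)%:R) * t ->
  (2 - 2 / m%:R) * q * bump t s m k <=
  k%:R * bump t s m k.-1 + (n%:R - k%:R) * bump t s m k.+1.
Proof.
move=> s0 m0 kn t0 q0 qs qn; pose a := bump t s m; rewrite -!/(a _).
have t0' := ltW t0.
have a0 i : 0 <= a i by rewrite mulr_ge0 ?exprn_ge0.
have kn' : 0 <= n%:R - k%:R :> R by rewrite subr_ge0 ler_nat.
have [skm|/bump_weight_eq0 w0] := boolP (s <= k < s + m)%N; last first.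
  by rewrite {1}/a /bump w0 !mulr0; apply: addr_ge0; apply: mulr_ge0.
have w2 := bump_weight_concave s0 skm.
have wm := bump_weight_ge skm.
case: k skm w2 wm kn kn' => [|k] /andP[sk km] w2 wm kn kn'.
  by move: sk; rewrite leqNgt s0.
rewrite /a /bump {a a0} [k.+1.-1]/= in w2 *.
move: (bump_weight s m k) (bump_weight s m k.+1) (bump_weight s m k.+2)
  w2 wm => u v w w2 wm.
have {}w2 : u%:R + w%:R = 2 * v%:R - 2 :> R.
  by rewrite -natrM -w2 !natrD addrK.
have le1 : q * t ^+ k.+1 * u%:R <= k.+1%:R * (t ^+ k * u%:R).
  have -> : q * t ^+ k.+1 * u%:R = (q * t) * (t ^+ k * u%:R).
    by rewrite exprS; ring.
  rewrite ler_wpM2r ?mulr_ge0 ?exprn_ge0 //.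
  by apply: (le_trans qs); rewrite ler_nat.
have le2 : q * t ^+ k.+1 * w%:R <= (n%:R - k.+1%:R) * (t ^+ k.+2 * w%:R).
  have -> : (n%:R - k.+1%:R) * (t ^+ k.+2 * w%:R) =
            ((n%:R - k.+1%:R) * t) * (t ^+ k.+1 * w%:R) by rewrite !exprS; ring.
  rewrite -mulrA ler_wpM2r ?mulr_ge0 ?exprn_ge0 //.
  apply: (le_trans qn); rewrite ler_pM2r //.
  have : k.+2%:R <= (s + m)%:R :> R by rewrite ler_nat.
  by rewrite -[k.+2%:R]natr1; lra.
apply: le_trans (lerD le1 le2).
rewrite -mulrDr w2.
have -> : (2 - 2 / m%:R) * q * (t ^+ k.+1 * v%:R) =
   q * t ^+ k.+1 * ((2 - 2 / m%:R) * v%:R) by ring.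
rewrite ler_wpM2l ?mulr_ge0 ?exprn_ge0 //.
rewrite mulrBl lerB // mulrAC ler_pdivlMr ?ltr0n //.
by rewrite ler_pM2l ?ltr0n // ler_nat.
Qed.

Definition weight_ball n r : {set {set 'I_n}} :=
  [set S : {set 'I_n} | (#|S| <= r)%N].

Lemma code_size_le_ball (R : realFieldType) n d (C : {set cube n})
    (s m : nat) (t q : R) :
  has_min_dist d C ->
  (0 < s)%N -> (0 < m)%N -> (s + m <= n.+1)%N ->
  0 < t -> 0 <= q -> q * t <= s%:R ->
  q <= (n%:R + 1 - (s + m)%:R) * t ->
  n%:R - 2 * d%:R <= (2 - 2 / m%:R) * q ->
  ((2 - 2 / m%:R) * q - n%:R + 2 * d%:R) * #|C|%:R <=
  2 * d%:R * #|weight_ball n (s + m).-1|%:R.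
Proof.
move=> Cd s0 m0 smn t0 q0 qs qn lamd.
pose f (S : {set 'I_n}) := bump t s m #|S|.
apply: (@code_size_le _ _ _ _ f) => //.
- by move=> S; rewrite mulr_ge0 ?exprn_ge0 // ltW.
- move=> S; rewrite sum_flip_card; apply: bump_adjacency => //.
  by rewrite -[leqRHS]card_ord max_card.
- move=> S; rewrite inE -ltnNge => Sm; rewrite /f /bump bump_weight_eq0 ?mulr0 //.
  by move: #|S| Sm => k; lia.
(* [f] is non-zero on the layer of size [s], which is inhabited because [s <= n]. *)
have /card_gt0P[S] : (0 < #|[set S : {set 'I_n} | #|S| == s]|)%N.
  by rewrite card_draws bin_gt0 card_ord; lia.
rewrite inE => /eqP Ss; exists S; rewrite /f /bump Ss mulf_neq0 ?expf_neq0 ?gt_eqF //.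
by rewrite ltr0n (leq_trans m0) // bump_weight_ge //; lia.
Qed.

(** * Volume of Hamming balls and entropy *)

Lemma ln2_gt0 (R : realType) : 0 < ln 2 :> R.
Proof. by rewrite ln_gt0 // ltr1n. Qed.

Lemma binary_entropyE (R : realType) (p : R) : 0 < p < 1 ->
  ln 2 * binary_entropy p = - (p * ln p) - (1 - p) * ln (1 - p).
Proof.
move=> p01; rewrite /binary_entropy p01 /log2.
by have := ln2_gt0 R => ln2; field; rewrite gt_eqF.
Qed.

Lemma sum_binomial_weights (R : comPzRingType) n (p : R) :
  \sum_(S : {set 'I_n}) p ^+ #|S| * (1 - p) ^+ (n - #|S|) = 1.
Proof.
have : \prod_(i < n) (p + (1 - p)) = 1 :> R.
  by rewrite prodr_const addrC subrK expr1n.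
rewrite bigA_distr => {2}<-; apply: eq_bigr => S _.
rewrite (bigID (mem S)) /=; congr (_ * _).
  rewrite -prodr_const; apply: eq_bigr => i iS; by rewrite iS.
have -> : (n - #|S| = #|~: S|)%N by rewrite [RHS]cardsCs finset.setCK card_ord.
rewrite -prodr_const; apply: eq_big => i; first by rewrite inE.
by rewrite inE => iS; rewrite (negbTE iS).
Qed.

(** Under the product measure with density [p] every set in the ball has mass at least
    [2^(-n H(p))], because [p <= 1 - p] keeps the mass from growing with the size; the masses add up
    to at most 1. *)
Lemma card_ball_le (R : realType) n r (p : R) :
  0 < p <= 2^-1 -> r%:R <= p * n%:R ->
  #|weight_ball n r|%:R <=
  expR (n%:R * (ln 2 * binary_entropy p)).
Proof.
move=> /andP[p0 p2] rpn.
have p1 : 0 < 1 - p by lra.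
rewrite binary_entropyE; last by apply/andP; split=> //; lra.
set E := n%:R * _.
rewrite -[leRHS]mul1r -[X in _ <= X * _](sum_binomial_weights n p) mulr_suml.
set B := weight_ball n r.
have -> : #|B|%:R = \sum_(S in B) 1 :> R by rewrite sumr_const.
rewrite [leRHS](bigID (mem B)) /=.
rewrite -[leLHS]addr0; apply: lerD; last first.
  apply: sumr_ge0 => S _.
  by rewrite mulr_ge0 ?expR_ge0 // mulr_ge0 ?exprn_ge0 // ltW.
apply: ler_sum => S; rewrite inE => Sr.
have Sn : (#|S| <= n)%N by rewrite -[leqRHS]card_ord max_card.
have -> : p ^+ #|S| * (1 - p) ^+ (n - #|S|) =
    expR (#|S|%:R * ln p + (n%:R - #|S|%:R) * ln (1 - p)).
  rewrite expRD -natrB // !expRM_natl.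
  by rewrite !lnK ?posrE.
rewrite -expRD -[leLHS]expR0 ler_expR /E.
have -> : #|S|%:R * ln p + (n%:R - #|S|%:R) * ln (1 - p) +
   n%:R * (- (p * ln p) - (1 - p) * ln (1 - p)) =
   (p * n%:R - #|S|%:R) * (ln (1 - p) - ln p) by ring.
rewrite mulr_ge0 // subr_ge0; first by apply: le_trans rpn; rewrite ler_nat.
by rewrite ler_ln ?posrE //; lra.
Qed.

(** A crude bound that serves twice: it makes [ln n / n] small for large [n] and [- p ln p] small
    for small [p]. *)
Lemma ln_le_2sqrt (R : realType) (x : R) : 0 < x -> ln x <= 2 * Num.sqrt x.
Proof.
move=> x0; have s0 : 0 < Num.sqrt x by rewrite sqrtr_gt0.
rewrite -{1}(sqr_sqrtr (ltW x0)) lnXn // -[leLHS]mulr_natl ler_pM2l //.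
exact/ltW/ln_sublinear.
Qed.

(** * From finite length to the asymptotic rate *)

Local Open Scope classical_set_scope.

Lemma limn_esup_le_near (R : realType) (u : nat -> \bar R) (a : \bar R) :
  (\forall n \near \oo, u n <= a)%E -> (limn_esup u <= a)%E.
Proof.
move=> [N _ Na]; rewrite limn_esup_lim; apply: lime_le.
  exact: is_cvg_esups.
exists N => // n /= Nn; apply: ge_ereal_sup => _ [k /= nk <-].
by apply: Na => /=; exact: leq_trans nk.
Qed.

Lemma max_code_size_le (R : realType) n d (x : R) : 0 <= x ->
  (forall C : {set cube n}, has_min_dist d C -> #|C|%:R <= x) ->
  (max_code_size n d)%:R <= x.
Proof.
move=> x0 Cx; rewrite /max_code_size.
elim/big_ind: _ => // u v ux vx.
by rewrite /maxn; case: ifP.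
Qed.

Lemma log2_rate_le (R : realType) (n N : nat) (B : R) :
  (0 < n)%N -> 1 <= B -> N%:R <= B ->
  n%:R^-1 * log2 N%:R <= ln B / (n%:R * ln 2).
Proof.
move=> n0 B1 NB; have ln2 := ln2_gt0 R.
have -> : n%:R^-1 * log2 N%:R = ln N%:R / (n%:R * ln 2) :> R.
  by rewrite /log2 invfM mulrCA mulrC mulrAC.
rewrite ler_pM2r ?invr_gt0 ?mulr_gt0 ?ltr0n //.
(* [ln 0 = 0] by convention, so the case [N = 0] rests on [1 <= B]. *)
case: N NB => [|N] NB; first by rewrite ln0 // ln_ge0.
by rewrite ler_ln ?posrE ?ltr0n //; lra.
Qed.

Lemma max_code_size_le_ball (R : realType) (delta p : R) :
  0 <= delta <= 2^-1 -> 0 < p < 2^-1 ->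
  1 - 2 * delta < 2 * Num.sqrt (p * (1 - p)) ->
  \forall n \near \oo,
    (max_code_size n (Num.truncn (delta * n%:R)))%:R <=
    n%:R * #|weight_ball n (Num.truncn (p * n%:R))|%:R :> R.
Proof.
move=> /andP[d0 d1] /andP[p0 p1] gap.
set mu := Num.sqrt _ in gap.
have pp0 : 0 < p * (1 - p) by rewrite mulr_gt0 //; lra.
have mu0 : 0 < mu by rewrite sqrtr_gt0.
have mu2 : mu * mu = p * (1 - p) by rewrite -expr2 sqr_sqrtr // ltW.
(* t = sqrt (p / (1 - p)) and mu = sqrt (p (1 - p)) *)
pose t := p / mu.
have t0 : 0 < t by rewrite divr_gt0.
have mut : mu * t = p by rewrite mulrC divfK // gt_eqF.
have tmu : (1 - p) * t = mu.
  by apply: (mulIf (lt0r_neq0 mu0)); rewrite mu2 -mulrA [t * _]mulrC mut mulrC.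
(* [g] is the room given by the gap; [m] is taken so large that the loss [2 * mu / m] leaves a
   positive part [g']. *)
pose g := 2 * mu - (1 - 2 * delta).
have g0 : 0 < g by rewrite /g; lra.
pose m := (Num.truncn (2 * mu / g)).+1.
have m0 : 0 < m%:R :> R by rewrite ltr0n.
have gm : 2 * mu / m%:R < g.
  by rewrite ltr_pdivrMr // [ltRHS]mulrC -ltr_pdivrMr //; exact: truncnS_gt.
pose g' := g - 2 * mu / m%:R.
have g'0 : 0 < g' by rewrite subr_gt0.
near=> n.
have n0 : 0 <= n%:R :> R by [].
have n1 : 1 <= n%:R :> R by near: n; exact: nbhs_infty_ger.
have pnm : m%:R <= p * n%:R.
  by rewrite [leRHS]mulrC -ler_pdivrMr //; near: n; exact: nbhs_infty_ger.
(* The 3 pays for the surplus 1 in [lam_ge] and for the rounding of [delta * n], which costs less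
   than 2. *)
have gn : 2 * (m%:R / t) + 3 <= g' * n%:R.
  by rewrite [leRHS]mulrC -ler_pdivrMr //; near: n; exact: nbhs_infty_ger.
set d := Num.truncn _; set r := Num.truncn _.
have /andP[dle dgt] : d%:R <= delta * n%:R < d.+1%:R.
  by apply: truncn_itv; rewrite mulr_ge0.
have /andP[rle rgt] : r%:R <= p * n%:R < r.+1%:R.
  by apply: truncn_itv; rewrite mulr_ge0 // ltW.
have mr : (m <= r)%N by rewrite truncn_ge_nat ?mulr_ge0 // ltW.
pose s := (r.+1 - m)%N.
have smr : (s + m = r.+1)%N by rewrite subnK // ltnW.
have sR : s%:R + m%:R = r%:R + 1 :> R by rewrite -natrD smr natr1.
have rn : (r <= n)%N.
  rewrite -(ler_nat R); apply: le_trans rle _.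
  by rewrite ger_pMl ?ltr0n -?(ltr_nat R); lra.
(* [mu * n] is lowered just enough that [q * t = p * n - m] stays below [s = r + 1 - m]. *)
pose q := mu * n%:R - m%:R / t.
have qt : q * t = p * n%:R - m%:R.
  by rewrite mulrBl divfK ?gt_eqF // mulrAC mut.
have q0 : 0 <= q by rewrite -(pmulr_lge0 _ t0) qt subr_ge0.
have lam_ge : 1 <= (2 - 2 / m%:R) * q - n%:R + 2 * d%:R.
  have -> : (2 - 2 / m%:R) * q - n%:R + 2 * d%:R =
    g' * n%:R - 2 * (m%:R / t) + 2 / m%:R * (m%:R / t)
      + 2 * (d%:R - delta * n%:R) by rewrite /q /g' /g; ring.
  have : 0 <= 2 / m%:R * (m%:R / t).
    by rewrite mulr_ge0 // divr_ge0 // ltW.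
  by move: dgt; rewrite -natr1; lra.
apply: max_code_size_le => [|C Cd]; first by rewrite mulr_ge0.
have s0 : (0 < s)%N by rewrite subn_gt0 ltnS.
have m0' : (0 < m)%N by [].
have smn : (s + m <= n.+1)%N by rewrite smr ltnS.
have qs : q * t <= s%:R by move: rgt sR; rewrite qt -natr1; lra.
have qn : q <= (n%:R + 1 - (s + m)%:R) * t.
  have -> : (n%:R + 1 - (s + m)%:R) * t = (n%:R - r%:R) * t.
    by rewrite smr -natr1; ring.
  have : (1 - p) * n%:R * t <= (n%:R - r%:R) * t by rewrite ler_pM2r //; lra.
  rewrite mulrAC tmu; apply: le_trans.
  by rewrite /q gerBl divr_ge0 // ltW.
have lamd : n%:R - 2 * d%:R <= (2 - 2 / m%:R) * q by lra.
have := code_size_le_ball Cd s0 m0' smn t0 q0 qs qn lamd.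
rewrite smr [r.+1.-1]/= => CB; apply: le_trans (_ : 2 * d%:R * _ <= _).
  by apply: le_trans CB; rewrite ler_peMl.
rewrite ler_wpM2r //; apply: (@le_trans _ _ (2 * delta * n%:R)).
  by rewrite -mulrA ler_pM2l.
by rewrite ger_pMl ?(lt_le_trans _ n1) //; lra.
Unshelve. all: by end_near. Qed.

Lemma asymptotic_rate_le_of_gap (R : realType) (delta p : R) :
  0 <= delta <= 2^-1 -> 0 < p < 2^-1 ->
  1 - 2 * delta < 2 * Num.sqrt (p * (1 - p)) ->
  (asymptotic_rate delta <= (binary_entropy p)%:E)%E.
Proof.
move=> dlt p01 gap; apply/lee_addgt0Pr => e e0; rewrite -EFinD.
have ln2 := ln2_gt0 R.
have e'0 : 0 < e * ln 2 / 2 by rewrite divr_gt0 ?mulr_gt0.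
apply: limn_esup_le_near.
near=> n; rewrite lee_fin.
have n1 : 1 <= n%:R :> R by near: n; exact: nbhs_infty_ger.
(* This threshold turns [ln n <= 2 sqrt n] into [ln n <= n * (e * ln 2)], so the factor [n] costs at
   most [e] in the rate. *)
have nge : (e * ln 2 / 2) ^- 2 <= n%:R by near: n; exact: nbhs_infty_ger.
have nC : (max_code_size n (Num.truncn (delta * n%:R)))%:R <=
    n%:R * #|weight_ball n (Num.truncn (p * n%:R))|%:R :> R.
  by near: n; exact: max_code_size_le_ball.
have n0 : 0 < n%:R :> R by rewrite (lt_le_trans _ n1).
have n0' : (0 < n)%N by rewrite -(ltr0n R).
set B := #|weight_ball n (Num.truncn (p * n%:R))|%:R : R.
have B1 : 1 <= B.
  rewrite ler1n card_gt0; apply/set0Pn; exists finset.set0.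
  by rewrite inE cards0.
have BH : ln B <= n%:R * (ln 2 * binary_entropy p).
  have /andP[p0 p2] := p01.
  rewrite -ler_expR lnK ?posrE ?(lt_le_trans _ B1) //.
  apply: card_ball_le; first by rewrite p0 ltW.
  by rewrite truncn_le mulr_ge0 // ltW.
apply: (@le_trans _ _ (ln (n%:R * B) / (n%:R * ln 2))).
  apply: log2_rate_le => //; by rewrite -[leLHS]mulr1 ler_pM.
rewrite ler_pdivrMr ?mulr_gt0 // lnM ?posrE // ?(lt_le_trans _ B1) //.
have lnn : ln n%:R <= n%:R * (e * ln 2).
  apply: (le_trans (ln_le_2sqrt n0)).
  have s0 : 0 < Num.sqrt (n%:R : R) by rewrite sqrtr_gt0.
  rewrite -{2}(sqr_sqrtr (ltW n0)) expr2 -mulrA mulrC ler_pM2l //.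
  rewrite -ler_pdivrMr ?mulr_gt0 //.
  have : Num.sqrt ((e * ln 2 / 2) ^- 2) <= Num.sqrt n%:R by rewrite ler_wsqrtr.
  rewrite -exprVn sqrtr_sqr ger0_norm; last by rewrite invr_ge0 ltW.
  by rewrite invf_div.
apply: le_trans (lerD lnn BH) _; rewrite -mulrDr [e * _]mulrC -mulrDr.
by rewrite [leRHS]mulrC [e + _]addrC mulrA.
Unshelve. all: by end_near. Qed.

(** * Entropy slightly to the right of a point *)

Lemma binary_entropy_small (R : realType) (e : R) : 0 < e ->
  exists p : R, 0 < p < 2^-1 /\ binary_entropy p <= e.
Proof.
move=> e0; have ln2 := ln2_gt0 R.
(* With [p = x ^ 2] the two entropy terms are at most [2 * x] and [x ^ 2 <= x / 2], in total below
   [e * ln 2]. *)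
pose x := Num.min 2^-1 (e * ln 2 / 4).
have x0 : 0 < x by rewrite lt_min invr_gt0 ltr0n divr_gt0 ?mulr_gt0.
have x2 : x <= 2^-1 by rewrite ge_min lexx.
have xe : x <= e * ln 2 / 4 by rewrite ge_min lexx orbT.
have p0 : 0 < x ^+ 2 by rewrite exprn_gt0.
have px : x ^+ 2 <= x / 2 by rewrite expr2 ler_wpM2l // ltW.
have p1 : 0 < 1 - x ^+ 2 by lra.
exists (x ^+ 2); split; first by rewrite p0 /=; lra.
rewrite -(ler_pM2l ln2) binary_entropyE; last by rewrite p0 /=; lra.
have le1 : - ((x ^+ 2) * ln (x ^+ 2)) <= 2 * x.
  have := ln_le_2sqrt (_ : 0 < (x ^+ 2)^-1).
  rewrite invr_gt0 => /(_ p0); rewrite lnV ?posrE // -exprVn sqrtr_sqr.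
  rewrite ger0_norm; last by rewrite invr_ge0 ltW.
  rewrite -(ler_pM2l p0) mulrN.
  have -> // : x ^+ 2 * (2 * x^-1) = 2 * x.
  by field; rewrite gt_eqF.
have le2 : - ((1 - x ^+ 2) * ln (1 - x ^+ 2)) <= x ^+ 2.
  have : ln (1 + ((1 - x ^+ 2)^-1 - 1)) <= (1 - x ^+ 2)^-1 - 1.
    by apply: le_ln1Dx; rewrite ltrBrDl subrr invr_gt0.
  rewrite [1 + _]addrC subrK lnV ?posrE // -(ler_pM2l p1) mulrN.
  have -> // : (1 - x ^+ 2) * ((1 - x ^+ 2)^-1 - 1) = x ^+ 2.
  by field; rewrite gt_eqF.
lra.
Qed.

Lemma binary_entropy_right_cont (R : realType) (rho e : R) :
  0 <= rho < 2^-1 -> 0 < e ->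
  exists p : R, [/\ rho < p, p < 2^-1 & binary_entropy p <= binary_entropy rho + e].
Proof.
move=> /andP[rho0 rho2] e0.
(* At 0 the logarithm is not continuous and the entropy takes its default branch. *)
have [->|rhon0] := eqVneq rho 0.
  have [p [/andP[p0 p2] pe]] := binary_entropy_small e0.
  by exists p; split=> //; rewrite [binary_entropy 0]/binary_entropy ltxx add0r.
have {rho0 rhon0} rho0 : 0 < rho by rewrite lt_def rhon0.
have ln2 := ln2_gt0 R.
pose F (x : R) := - (x * ln x) - (1 - x) * ln (1 - x).
have Fc : {for rho, continuous F}.
  have l1 : ln x @[x --> rho] --> ln rho by exact: continuous_ln.
  have s1 : 1 - x @[x --> rho] --> 1 - rho.
    by apply: cvgB; [exact: cvg_cst|exact: cvg_id].
  have l2 : ln (1 - x) @[x --> rho] --> ln (1 - rho).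
    apply: (cvg_comp _ _ s1); apply: continuous_ln; lra.
  apply: cvgB; last exact: cvgM.
  by apply: cvgN; apply: cvgM => //; exact: cvg_id.
have Fn : \forall x \near rho, F x < F rho + e * ln 2.
  have F_lt : F rho < F rho + e * ln 2 by rewrite ltrDl mulr_gt0.
  exact: (cvgr_lt _ Fc _ F_lt).
have : \forall x \near rho^'+, [/\ rho < x, x < 2^-1 & F x < F rho + e * ln 2].
  near=> x; split; near: x.
  - exact: nbhs_right_gt.
  - exact: nbhs_right_lt.
  - exact: cvg_within.
case/filter_ex => p [rp p2 /ltW pF]; exists p; split=> //.
rewrite -(ler_pM2l ln2) mulrDr !binary_entropyE ?(mulrC (ln 2) e) //.
  by rewrite rho0 /=; lra.
by apply/andP; split; [exact: lt_trans rp|lra].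
Unshelve. all: by end_near. Qed.

(** * The case [delta = 0] and the conclusion *)

Lemma max_code_size_le_card (n d : nat) : (max_code_size n d <= 2 ^ n)%N.
Proof.
apply/bigmax_leqP => C _; apply: (leq_trans (max_card _)).
by rewrite card_ffun card_bool card_ord.
Qed.

Lemma asymptotic_rate_le1 (R : realType) (delta : R) :
  (asymptotic_rate delta <= 1%:E)%E.
Proof.
apply: limn_esup_le_near; near=> n; rewrite lee_fin.
have n0 : (0 < n)%N by near: n; exact: nbhs_infty_gt.
have ln2 := ln2_gt0 R.
apply: (le_trans (@log2_rate_le _ _ _ (2 ^+ n) _ _ _)) => //.
- by rewrite exprn_ege1 // ler1n.
- by rewrite -natrX ler_nat max_code_size_le_card.
by rewrite lnXn // -[ln 2 *+ n]mulr_natl divff // mulf_neq0 ?gt_eqF ?ltr0n.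
Unshelve. all: by end_near. Qed.

Lemma binary_entropy_half (R : realType) : binary_entropy (2^-1 : R) = 1.
Proof.
have ln2 := ln2_gt0 R.
apply: (mulfI (lt0r_neq0 ln2)); rewrite binary_entropyE; last by apply/andP; lra.
have -> : 1 - 2^-1 = 2^-1 :> R by lra.
by rewrite lnV ?posrE //; lra.
Qed.

Local Close Scope classical_set_scope.

Theorem mainTheorem6 (R : realType) (delta : R)
    (hdelta : 0 <= delta <= 2^-1) :
  (asymptotic_rate delta <=
   (binary_entropy (2^-1 - Num.sqrt (delta * (1 - delta))))%:E)%E.
Proof.
(* For [delta = 0] the entropy is taken at 1/2, which leaves no [p] between that point and 1/2; the
   trivial bound 1 suffices. *)
have [->|delta0] := eqVneq delta 0.
  by rewrite mul0r sqrtr0 subr0 binary_entropy_half; exact: asymptotic_rate_le1.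
have /andP[d0 d2] := hdelta.
have {delta0} d_gt0 : 0 < delta by rewrite lt_def delta0.
have dd0 : 0 < delta * (1 - delta) by rewrite mulr_gt0 //; lra.
set w := Num.sqrt _.
have w0 : 0 < w by rewrite sqrtr_gt0.
have w2 : w ^+ 2 = delta * (1 - delta) by rewrite sqr_sqrtr // ltW.
have wle : w <= 2^-1.
  rewrite -(@ler_pXn2r _ 2) ?nnegrE ?(ltW w0) // w2.
  by have := sqr_ge0 (delta - 2^-1); rewrite !expr2; lra.
apply/lee_addgt0Pr => e e0; rewrite -EFinD.
have rho : 0 <= 2^-1 - w < 2^-1 by apply/andP; split; lra.
have [p [rp p2 pe]] := binary_entropy_right_cont rho e0.
apply: (@le_trans _ _ (binary_entropy p)%:E); last by rewrite lee_fin.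
apply: asymptotic_rate_le_of_gap => //; first by apply/andP; split=> //; lra.
rewrite [ltRHS]mulrC -ltr_pdivrMr //.
have -> : (1 - 2 * delta) / 2 = Num.sqrt ((2^-1 - delta) ^+ 2).
  by rewrite sqrtr_sqr ger0_norm; lra.
rewrite ltr_sqrt; last by rewrite mulr_gt0; lra.
(* As [(1/2 - delta)^2 = 1/4 - w^2], the difference of the two sides is [w^2 - (1/2 - p)^2], which
   factors into this product. *)
have : 0 < (p - (2^-1 - w)) * (2^-1 + w - p) by rewrite mulr_gt0; lra.
by move: w2; rewrite !expr2; nra.
Qed.
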